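(* Let $X$ be a weakly non-null and $\alpha$-summable stationary ergodic process with finite alphabet $A$. Then there exist $\lambda_1,\lambda_2>0$ depending only on the distribution of $X$ such that for any sequence $k_n$, $n\in\mathbb N$, \[ \Pr\bigl(\hat k_{\mathrm{IC}}(X_1^n)>k_n\bigr)\le 2^{\lambda_1+2\log n-\lambda_2k_n}, \] where IC is either the PML criterion with an arbitrary penalty function $\mathrm{pen}(n)$, or the NML criterion, or the KT criterion.
   Context: $A$ finite alphabet, $|A|\ge2$; $X=\{X_i\}_{i\in\mathbb Z}$ stationary ergodic with values in $A$; $P(a|x_{-\infty}^{-1})$ the conditional probability of $X_0=a$ given the infinite past; logs base 2. Weakly non-null: $\alpha_0=\sum_{a}\inf_{x_{-\infty}^{-1}}P(a|x_{-\infty}^{-1})>0$. $\alpha_k=\min_{y_{-k}^{-1}\in A^k}\sum_a\inf_{x_{-\infty}^{-1}:x_{-k}^{-1}=y_{-k}^{-1}}P(a|x_{-\infty}^{-1})$ ($k\ge1$); $\alpha$-summable: $\sum_{k\ge0}(1-\alpha_k)<\infty$. Sample counts $N_n(a_1^k)=|\{i:0\le i\le n-k,\ X_{i+1}^{i+k}=a_1^k\}|$, $\hat P(a_{k+1}|a_1^k)=N_n(a_1^{k+1})/N_{n-1}(a_1^k)$ (for $k=0$, $N_n(a)/n$). Maximum likelihood $\mathrm{ML}_k(X_1^n)=\prod_{a_1^{k+1}}\hat P(a_{k+1}|a_1^k)^{N_n(a_1^{k+1})}$, $0\le k<n$. A penalty function $\mathrm{pen}(n)$ is a non-decreasing function of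 $n$. Criteria for candidate order $0\le k<n$: $\mathrm{PML}_{X_1^n}(k)=-\log\mathrm{ML}_k(X_1^n)+(|A|-1)|A|^k\mathrm{pen}(n)$; $\mathrm{NML}_{X_1^n}(k)=-\log\mathrm{ML}_k(X_1^n)+\log\Sigma(n,k)$ with $\Sigma(n,k)=\sum_{x_1^n\in A^n}\mathrm{ML}_k(x_1^n)$; $\mathrm{KT}_{X_1^n}(k)=-\log P_{\mathrm{KT},k}(X_1^n)$ where $P_{\mathrm{KT},k}(X_1^n)=|A|^{-k}\prod_{a_1^k:N_{n-1}(a_1^k)\ge1}\frac{\prod_{a_{k+1}:N_n(a_1^{k+1})\ge1}(N_n(a_1^{k+1})-\frac12)(N_n(a_1^{k+1})-\frac32)\cdots\frac12}{(N_{n-1}(a_1^k)-1+\frac{|A|}2)(N_{n-1}(a_1^k)-2+\frac{|A|}2)\cdots\frac{|A|}2}$ (for $k=0$, $N_{n-1}(a_1^k)=n$). The Markov order estimator is $\hat k_{\mathrm{IC}}(X_1^n)=\arg\min_{0\le k<n}\mathrm{IC}_{X_1^n}(k)$, taking the smallest minimizer.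
   Formalization: For the PML criterion the penalty function pen(n) is also required to be nonnegative; with a negative constant penalty the PML estimator always equals n-1, so the stated bound fails for k_n = n-2 and large n. *)

(* Defs.v *)
From HB Require Import structures.
From mathcomp Require Import all_boot all_order all_algebra.
From mathcomp Require Import all_classical all_reals all_analysis.
Set Implicit Arguments. Unset Strict Implicit. Unset Printing Implicit Defensive.
Import Order.TTheory GRing.Theory Num.Theory.
Import numFieldNormedType.Exports.
Local Open Scope classical_set_scope.
Local Open Scope ring_scope.

Section Defs.
Variables (R : realType) (A : finType).

Definition log2 (x : R) : R := ln x / ln 2.

Definition cylinders : set (set (int -> A)) :=
  [set [set x : int -> A | x i = a] | i in [set: int] & a in [set: A]].

Definition path_measurable : set (set (int -> A)) := <<s cylinders >>.

Definition path_shift (x : int -> A) : int -> A := fun i => x (i + 1).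

(** x_{-k}^{-1} = y, with y = (y_{-k},...,y_{-1}) stored as a k-tuple *)
Definition past_agree (k : nat) (y : k.-tuple A) (x : int -> A) : Prop :=
  forall j : 'I_k, x (j%:Z - k%:Z) = tnth y j.

(** alpha_k = min_{y in A^k} sum_a inf_{x : x_{-k}^{-1} = y} P(a | x_{-oo}^{-1});
    for k = 0 this is alpha_0 (the condition on the past is vacuous). *)
Definition alpha (p : A -> (int -> A) -> R) (k : nat) : R :=
  inf (range (fun y : k.-tuple A =>
    \sum_(a : A) inf [set p a x | x in past_agree y])).

Definition Ncnt (s : seq A) (m : nat) (w : seq A) : nat :=
  \sum_(0 <= i < m.+1 - size w) (take (size w) (drop i s) == w).

(** maximum likelihood ML_k(x_1^n), with 0^0 = 1 *)
Definition ML (s : seq A) (k : nat) : R :=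
  let n := size s in
  \prod_(c : k.-tuple A) \prod_(a : A)
     ((Ncnt s n (rcons c a))%:R / (Ncnt s n.-1 c)%:R) ^+ (Ncnt s n (rcons c a)).

Definition NMLsum (n k : nat) : R := \sum_(t : n.-tuple A) ML t k.

Definition PKT (s : seq A) (k : nat) : R :=
  let n := size s in
  (#|A|%:R ^- k) *
  \prod_(c : k.-tuple A | (1 <= Ncnt s n.-1 c)%N)
    ((\prod_(a : A | (1 <= Ncnt s n (rcons c a))%N)
        \prod_(0 <= j < Ncnt s n (rcons c a)) (j%:R + 2^-1)) /
     (\prod_(0 <= j < Ncnt s n.-1 c) (j%:R + #|A|%:R / 2))).

Definition PML_IC (pen : nat -> R) (s : seq A) (k : nat) : R :=
  - log2 (ML s k) + ((#|A| - 1) * #|A| ^ k)%:R * pen (size s).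

Definition NML_IC (s : seq A) (k : nat) : R :=
  - log2 (ML s k) + log2 (NMLsum (size s) k).

Definition KT_IC (s : seq A) (k : nat) : R := - log2 (PKT s k).

Definition khat (IC : seq A -> nat -> R) (s : seq A) : nat :=
  let n := size s in
  find (fun k => [forall j : 'I_n, IC s k <= IC s j]) (iota 0 n).

Definition penalty_function (pen : nat -> R) : Prop :=
  forall m m' : nat, (m <= m')%N -> pen m <= pen m'.

End Defs.

Definition path_of {T : Type} {A : Type} (X : int -> T -> A) (w : T) : int -> A :=
  fun i => X i w.

Definition sample {T : Type} {A : Type} (X : int -> T -> A) (n : nat) (w : T) : seq A :=
  [seq X (Posz i.+1) w | i <- iota 0 n].

Arguments path_shift {A} x i.
Arguments path_measurable {A} _.
Arguments past_agree {A k} y x.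
Arguments alpha {R A} p k.

(* Main.v *)
(** If the symbol following a length-[k] context is determined by that context
    throughout the sample, then the likelihood of every order [m >= k] is [1] and
    each of the three criteria is nondecreasing from [k] on, so the estimator is at
    most [k]. Otherwise some word of length [k] occurs at two places [i < j] of the
    sample. Given the first [j] symbols, such a repetition forces the next [k] ones,
    so it suffices to bound [P(u v) <= rho ^ floor(|v| / m) * P(u)] for all words.

    Pick [a] with [inf P(a | .) > 0], so that every symbol other than [a] has
    conditional probability bounded away from [1]. Let [l_i] be the infimum of
    [P(a | .)] over pasts ending in [a^i]. If [l_i < alpha_i] for some [i], then a
    symbol other than [a] has conditional probability at least [alpha_i - l_i]
    after [a^i], and words of length [m = i + 1] give the required bound.
    If [l_i >= alpha_i] for all [i], summability gives [P(a^n) >= prod l_i >= c > 0]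
    for all [n]; by ergodicity the process is then constant, every sample is
    determined at order [0], and the estimator is [0]. *)
Require Import Defs.
From HB Require Import structures.
From mathcomp Require Import all_boot all_order all_algebra.
From mathcomp Require Import all_classical all_reals all_analysis.
From mathcomp Require Import zify ring.
Import Order.TTheory GRing.Theory Num.Theory.
Import numFieldNormedType.Exports.
Local Open Scope classical_set_scope.
Local Open Scope ring_scope.

Set Implicit Arguments.
Unset Strict Implicit.
Unset Printing Implicit Defensive.

(** Splits off the oldest symbol of a context, to compare order [k.+1] with order [k]. *)
Lemma big_tuple_cons (A : finType) (S : Type) (idx : S)
    (op : Monoid.com_law idx) (k : nat) (F : seq A -> S) :
  \big[op/idx]_(c : k.+1.-tuple A) F c =
  \big[op/idx]_(b : A) \big[op/idx]_(c : k.-tuple A) F (b :: c).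
Proof.
rewrite pair_big /= (reindex (fun q : A * k.-tuple A => [tuple of q.1 :: q.2])) //=.
exists (fun t : k.+1.-tuple A => (thead t, [tuple of behead t])) => /= [[b c] _|t _].
  by congr pair; apply: val_inj.
by rewrite -tuple_eta.
Qed.

(** * Word counts and samples determined by their contexts *)

Section Counts.
Variable A : finType.
Implicit Types (s c w : seq A) (a b : A) (i j k m : nat).

Lemma Ncnt_ctxE s c : (0 < size s)%N ->
  Ncnt s (size s).-1 c =
  (\sum_(0 <= i < size s - size c) (take (size c) (drop i s) == c))%N.
Proof. by move=> s0; rewrite /Ncnt prednK. Qed.

Lemma Ncnt_rconsE s c a :
  Ncnt s (size s) (rcons c a) =
  (\sum_(0 <= i < size s - size c)
     (take (size c).+1 (drop i s) == rcons c a))%N.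
Proof. by rewrite /Ncnt size_rcons subSS. Qed.

Lemma take_window_rcons x0 s i k : (i + k < size s)%N ->
  take k.+1 (drop i s) = rcons (take k (drop i s)) (nth x0 s (i + k)).
Proof.
by move=> ik; rewrite (take_nth x0) ?nth_drop // size_drop ltn_subRL.
Qed.

(** The context count stops one symbol before the end, so each counted occurrence has exactly one
    successor in the sample. *)
Lemma sum_Ncnt_rcons s c : (0 < size s)%N ->
  (\sum_a Ncnt s (size s) (rcons c a))%N = Ncnt s (size s).-1 c.
Proof.
move=> s0; rewrite Ncnt_ctxE //; under eq_bigr do rewrite Ncnt_rconsE.
rewrite exchange_big; apply: eq_big_nat => i /andP[_ ilt].
have x0 : A by case: (s) s0.
under eq_bigr => a _.
  rewrite (take_window_rcons x0) ?eqseq_rcons; last by rewrite addnC -ltn_subRL.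
  over.
rewrite (bigD1 (nth x0 s (i + size c))) //= eqxx andbT big1 ?addn0 // => a.
by rewrite eq_sym => /negbTE ->; rewrite andbF.
Qed.

(** Every occurrence has exactly one preceding letter, except the one at the start of [s], which
    gives the indicator. *)
Lemma Ncnt_cons_sum s m w : (m <= size s)%N -> (size w <= m)%N ->
  Ncnt s m w = ((take (size w) s == w) + \sum_b Ncnt s m (b :: w))%N.
Proof.
move=> ms wm; rewrite /Ncnt subSn // big_nat_recl // drop0; congr addn.
rewrite exchange_big; apply: eq_big_nat => i /andP[_ ilt].
have x0 : A.
  by case: (s) ms ilt => [|x //]; rewrite leqn0 => /eqP ->; rewrite sub0n.
have ilt' : (i < size s)%N by apply: leq_trans ms; rewrite (leq_trans ilt) ?leq_subr.
under eq_bigr do rewrite (drop_nth x0 ilt') /= eqseq_cons.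
rewrite (bigD1 (nth x0 s i)) //= eqxx big1 ?addn0 // => b.
by rewrite eq_sym => /negbTE ->.
Qed.

Lemma leq_sum_Ncnt_cons s m w : (m <= size s)%N ->
  (\sum_b Ncnt s m (b :: w) <= Ncnt s m w)%N.
Proof.
move=> ms; case: (leqP (size w) m) => wm.
  by rewrite (Ncnt_cons_sum ms wm) leq_addl.
rewrite big1 // => b _; rewrite /Ncnt (_ : _ - _ = 0)%N ?big_geq //=.
by apply/eqP; rewrite subn_eq0 ltnS ltnW.
Qed.

(* The next symbol of the sample is a function of its [k] predecessors. *)
Definition determ s k := forall i j, (i + k < size s)%N -> (j + k < size s)%N ->
  take k (drop i s) = take k (drop j s) ->
  take k.+1 (drop i s) = take k.+1 (drop j s).

(** A window of length [k.+1] is one letter followed by the window of length [k] starting one place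
    later. *)
Lemma determS s k : determ s k -> determ s k.+1.
Proof.
move=> ds i j ik jk.
have x0 : A by case: (s) ik.
have il : (i < size s)%N by rewrite (leq_ltn_trans _ ik) // leq_addr.
have jl : (j < size s)%N by rewrite (leq_ltn_trans _ jk) // leq_addr.
rewrite (drop_nth x0 il) (drop_nth x0 jl) => -[-> e].
rewrite -(cat1s _ (drop i.+1 s)) -(cat1s _ (drop j.+1 s)) !take_cat /=.
by congr cons; apply: ds; rewrite ?addSnnS.
Qed.

Lemma determ_leq s k m : (k <= m)%N -> determ s k -> determ s m.
Proof. by move=> /subnK <- ds; elim: (m - k)%N => // l; apply: determS. Qed.

Lemma determ_Ncnt s c a : (0 < size s)%N -> determ s (size c) ->
  (0 < Ncnt s (size s) (rcons c a))%N ->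
  Ncnt s (size s) (rcons c a) = Ncnt s (size s).-1 c.
Proof.
move=> s0 ds; rewrite Ncnt_ctxE // Ncnt_rconsE => N0.
have [i0 i0lt /eqP ei0] : exists2 i0, (i0 < size s - size c)%N &
    take (size c).+1 (drop i0 s) == rcons c a.
  apply: contrapT => nex; move: N0; rewrite big_nat big1 // => i /andP[_ ilt].
  by case: eqP => // /eqP e; case: nex; exists i.
have x0 : A by case: (s) s0.
have takec i : (i < size s - size c)%N ->
    take (size c).+1 (drop i s) = rcons c a -> take (size c) (drop i s) = c.
  rewrite ltn_subRL addnC => ilt; rewrite (take_window_rcons x0) // => /eqP.
  by rewrite eqseq_rcons => /andP[/eqP].
apply: eq_big_nat => i /andP[_ ilt]; congr nat_of_bool; apply/eqP/eqP.
  exact: takec.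
move=> e; rewrite -ei0; apply: ds; rewrite 1?addnC -?ltn_subRL //.
by rewrite e takec.
Qed.

Lemma determ_const s a : (forall i, (i < size s)%N -> nth a s i = a) ->
  determ s 0.
Proof.
move=> sa i j; rewrite !addn0 => il jl _.
by rewrite (drop_nth a il) (drop_nth a jl) /= !take0 !sa.
Qed.

End Counts.

(** * The estimator, and monotonicity of the criteria on determined samples *)

Lemma khat_leq (R : realType) (A : finType) (IC : seq A -> nat -> R) s k :
  (0 < size s)%N ->
  (forall m, (k <= m < size s)%N -> IC s k <= IC s m) -> (khat IC s <= k)%N.
Proof.
move=> s0 ICk; rewrite /khat.
set P := fun k => _.
have fs : (find P (iota 0 (size s)) <= size s)%N.
  by rewrite -[leqRHS](size_iota 0) find_size.
case: (leqP (size s) k) => [|ks]; first exact: leq_trans.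
rewrite leqNgt; apply/negP => kf.
have bef j : (j < find P (iota 0 (size s)))%N -> P j = false.
  move=> jf; rewrite -(before_find 0%N jf) nth_iota //; exact: leq_trans fs.
pose i0 : 'I_(size s) := Ordinal ks.
have [|j0 _ j0min] := @arg_minP _ R _ i0 predT (fun j => IC s j); first by [].
(* [find] stops at the first global minimizer. Either [j0 <= k] is one, or [IC s k <= IC s j0] makes
   [k] itself one. *)
have [j0k|kj0] := leqP j0 k.
  have := bef _ (leq_ltn_trans j0k kf).
  by move/negP; apply; apply/forallP => j; apply: j0min.
move/negP: (bef _ kf); apply; apply/forallP => j.
by apply: le_trans (j0min j isT); apply: ICk; rewrite ltn_ord ltnW.
Qed.

Section Criteria.
Variables (R : realType) (A : finType).
Implicit Types (s c w : seq A) (a b : A) (i j k m n : nat).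

Local Notation emp s c a :=
  ((Ncnt s (size s) (rcons c a))%:R / (Ncnt s (size s).-1 c)%:R : R).

(* Maximum likelihood is maximal: termwise [y <= expR (y - 1)] for
   [y = q a * (\sum N) / N a]. *)
Lemma gibbs (N : A -> nat) (q : A -> R) :
  (forall a, 0 <= q a) -> \sum_a q a <= 1 ->
  \prod_a q a ^+ N a <= \prod_a ((N a)%:R / (\sum_a' N a')%:R) ^+ N a.
Proof.
move=> q0 q1; set M := (\sum_a' N a')%N.
have termwise a : q a ^+ N a <=
    ((N a)%:R / M%:R) ^+ N a * expR (M%:R * q a - (N a)%:R).
  case: (posnP (N a)) => [->|Na].
    rewrite !expr0 mul1r subr0; apply: le_trans (expR_ge1Dx _).
    by rewrite lerDl mulr_ge0.
  have M0 : (0 < M)%N by rewrite (leq_trans Na) // /M (bigD1 a) //= leq_addr.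
  have Na' : (N a)%:R != 0 :> R by rewrite pnatr_eq0 -lt0n.
  have M0' : M%:R != 0 :> R by rewrite pnatr_eq0 -lt0n.
  rewrite [X in expR X](_ : _ = (q a * M%:R / (N a)%:R - 1) * (N a)%:R); last first.
    by rewrite mulrBl mul1r mulfVK // mulrC.
  rewrite expRM_natr -exprMn lerXn2r ?nnegrE ?mulr_ge0 ?invr_ge0 ?expR_ge0 //.
  rewrite -[leLHS](_ : (N a)%:R / M%:R * (q a * M%:R / (N a)%:R) = q a); last first.
    by field; rewrite Na' M0'.
  rewrite ler_wpM2l ?mulr_ge0 ?invr_ge0 //.
  by apply: le_trans (expR_ge1Dx _); rewrite addrC subrK.
apply: (@le_trans _ _ (\prod_a (((N a)%:R / M%:R) ^+ N a *
    expR (M%:R * q a - (N a)%:R)))).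
  by apply: ler_prod => a _; rewrite exprn_ge0 //= termwise.
rewrite big_split /= -expR_sum -[leRHS]mulr1 ler_wpM2l //.
  by apply: prodr_ge0 => a _; rewrite exprn_ge0 ?mulr_ge0 ?invr_ge0.
rewrite -[leRHS]expR0 ler_expR sumrB -mulr_sumr -natr_sum subr_le0.
by rewrite -[leRHS]mulr1 ler_wpM2l.
Qed.

Lemma emp_ge0 s c a : 0 <= emp s c a.
Proof. by rewrite mulr_ge0 ?invr_ge0. Qed.

Lemma sum_emp_le1 s c : (0 < size s)%N -> \sum_a emp s c a <= 1.
Proof.
move=> s0; rewrite -mulr_suml -natr_sum sum_Ncnt_rcons //.
have [->|?] := eqVneq (Ncnt s (size s).-1 c) 0%N; first by rewrite mul0r.
by rewrite mulfV ?pnatr_eq0.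
Qed.

Lemma emp_le1 s c a : (0 < size s)%N -> emp s c a <= 1.
Proof.
move=> s0; apply: le_trans (sum_emp_le1 c s0); rewrite (bigD1 a) //= lerDl.
by apply: sumr_ge0 => b _; apply: emp_ge0.
Qed.

Lemma ML_gt0 s k : (0 < size s)%N -> 0 < ML R s k.
Proof.
move=> s0; apply: prodr_gt0 => c _; apply: prodr_gt0 => a _.
case: (posnP (Ncnt s (size s) (rcons c a))) => [->|N0]; first by rewrite expr0.
rewrite exprn_gt0 // divr_gt0 ?ltr0n // -sum_Ncnt_rcons //.
by rewrite (bigD1 a) //= addn_gt0 N0.
Qed.

(** Split the occurrences of [c] by the preceding letter [b]. The initial occurrence drops out,
    which only removes factors at most [1]; for each [b] the order-[k] frequencies are then one
    admissible [q] in [gibbs]. *)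
Lemma ML_leS s k : (0 < size s)%N -> ML R s k <= ML R s k.+1.
Proof.
move=> s0; pose N w := Ncnt s (size s) w.
rewrite /ML (@big_tuple_cons _ _ _ _ k (fun c => \prod_a emp s c a ^+ N (rcons c a))).
rewrite [leRHS]exchange_big /=; apply: ler_prod => c _; apply/andP; split.
  by apply: prodr_ge0 => a _; rewrite exprn_ge0 ?emp_ge0.
apply: (@le_trans _ _ (\prod_b \prod_a emp s c a ^+ N (rcons (b :: c) a))).
  rewrite [leRHS]exchange_big /=; apply: ler_prod => a _.
  rewrite exprn_ge0 ?emp_ge0 //= -expr_sum ler_wiXn2l ?emp_ge0 ?emp_le1 //.
  exact: leq_sum_Ncnt_cons.
apply: ler_prod => b _; apply/andP; split.
  by apply: prodr_ge0 => a _; rewrite exprn_ge0 ?emp_ge0.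
have := @gibbs (fun a => N (rcons (b :: c) a)) (fun a => emp s c a)
  (emp_ge0 s c) (sum_emp_le1 c s0).
by rewrite /N (sum_Ncnt_rcons (b :: c) s0).
Qed.

Lemma ML_leq s k m : (0 < size s)%N -> (k <= m)%N -> ML R s k <= ML R s m.
Proof.
move=> s0 /subnK <-; elim: (m - k)%N => // l /le_trans; apply.
by rewrite addSn ML_leS.
Qed.

Lemma ML_determ s k : (0 < size s)%N -> determ s k -> ML R s k = 1.
Proof.
move=> s0 ds; rewrite /ML big1 // => c _; rewrite big1 // => a _.
case: (posnP (Ncnt s (size s) (rcons c a))) => [->|N0]; first by rewrite expr0.
rewrite -(determ_Ncnt s0 _ N0) ?size_tuple // divff ?expr1n //.
by rewrite pnatr_eq0 -lt0n.
Qed.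

Lemma NMLsum_leq n k m : (0 < #|A|)%N -> (0 < n)%N -> (k <= m)%N ->
  0 < NMLsum R A n k <= NMLsum R A n m.
Proof.
move=> /card_gt0P[a _] n0 km; apply/andP; split; last first.
  by apply: ler_sum => t _; apply: ML_leq; rewrite ?size_tuple.
rewrite /NMLsum (bigD1 (nseq_tuple n a)) //= ltr_pwDl ?ML_gt0 ?size_nseq //.
by apply: sumr_ge0 => t _; rewrite ltW // ML_gt0 ?size_tuple.
Qed.

Lemma log2_le (x y : R) : 0 < x -> x <= y -> log2 x <= log2 y.
Proof.
move=> x0 xy; rewrite /log2 ler_wpM2r ?invr_ge0 ?ln_ge0 ?ler1n //.
by rewrite ler_ln ?posrE // (lt_le_trans x0).
Qed.

Lemma log2_1 : log2 1 = 0 :> R.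
Proof. by rewrite /log2 ln1 mul0r. Qed.

(* The Krichevsky-Trofimov weight of a context that occurs [N] times, each time
   followed by the same symbol. *)
Definition kt_run (N : nat) : R :=
  \prod_(0 <= j < N) ((j%:R + 2^-1) / (j%:R + #|A|%:R / 2)).

Lemma kt_run_gt0 N : (0 < #|A|)%N -> 0 < kt_run N.
Proof.
move=> A0; apply: prodr_gt0 => j _; apply: divr_gt0.
  by rewrite ltr_wpDl ?invr_gt0.
by rewrite ltr_wpDl // divr_gt0 ?ltr0n.
Qed.

Lemma ler_shift_ratio (x y h : R) : 0 <= x <= y -> 2^-1 <= h ->
  (x + 2^-1) / (x + h) <= (y + 2^-1) / (y + h).
Proof.
move=> /andP[x0 xy] h2; have h0 : 0 < h by apply: lt_le_trans h2; rewrite invr_gt0.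
have xh : 0 < x + h by rewrite ltr_wpDl.
have yh : 0 < y + h by rewrite ltr_wpDl // (le_trans x0).
rewrite ler_pdivrMr // mulrAC ler_pdivlMr // -subr_ge0.
rewrite (_ : _ - _ = (y - x) * (h - 2^-1)); last by field.
by rewrite mulr_ge0 ?subr_ge0.
Qed.

(** The factors of a run grow with [j] because [#|A| / 2 >= 1 / 2], so a run continued from [N]
    weighs at least as much as one restarted from [0]. *)
Lemma kt_run_mul N M : (0 < #|A|)%N -> kt_run N * kt_run M <= kt_run (N + M).
Proof.
move=> A0; rewrite {3}/kt_run (@big_cat_nat _ _ _ N) ?leq_addr //=.
rewrite ler_wpM2l ?(ltW (kt_run_gt0 _ _)) //.
rewrite -{1}[N]add0n big_addn addKn; apply: ler_prod => j _; apply/andP; split.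
  by rewrite mulr_ge0 ?invr_ge0 ?addr_ge0 ?invr_ge0 ?divr_ge0.
have h2 : 2^-1 <= #|A|%:R / 2 :> R.
  by rewrite -[leLHS]mul1r ler_wpM2r ?invr_ge0 // ler1n.
rewrite natrD; apply: ler_shift_ratio => //; by rewrite ler0n lerDl ler0n.
Qed.

Lemma kt_run_prod_leq (f : A -> nat) : (0 < #|A|)%N ->
  \prod_a kt_run (f a) <= kt_run (\sum_a f a).
Proof.
move=> A0; elim: (index_enum A) => [|a l IHl].
  by rewrite !big_nil /kt_run big_geq.
rewrite !big_cons; apply: le_trans (kt_run_mul _ _ A0).
by rewrite ler_wpM2l // ltW // kt_run_gt0.
Qed.

(** Each occurring context has a single successor, whose count is the full context count, so
    numerator and denominator pair off factor by factor. *)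
Lemma PKT_determ s k : (0 < size s)%N -> determ s k ->
  PKT R s k = #|A|%:R ^- k * \prod_(c : k.-tuple A) kt_run (Ncnt s (size s).-1 c).
Proof.
move=> s0 ds; rewrite /PKT; congr (_ * _); rewrite big_mkcond /=.
apply: eq_bigr => c _; case: posnP => [->|N0]; first by rewrite /kt_run big_geq.
rewrite /kt_run prodf_div; congr (_ / _).
have ds' : determ s (size c) by rewrite size_tuple.
have [a Na] : exists a, (0 < Ncnt s (size s) (rcons c a))%N.
  apply: contrapT => nex; move: N0; rewrite -sum_Ncnt_rcons // big1 // => a _.
  by apply/eqP; rewrite -leqn0 leqNgt; apply/negP => Na; apply: nex; exists a.
rewrite (big_pred1 a) => [|b /=]; first by rewrite (determ_Ncnt s0 ds' Na).
apply/idP/eqP => [Nb|-> //]; apply: contrapT => /eqP ba.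
have := sum_Ncnt_rcons c s0; rewrite (bigD1 a) //= (bigD1 b) //=.
by rewrite (determ_Ncnt s0 ds' Na) (determ_Ncnt s0 ds' Nb); lia.
Qed.

Lemma PKT_gt0 s k : (0 < #|A|)%N -> (0 < size s)%N -> determ s k -> 0 < PKT R s k.
Proof.
move=> A0 s0 ds; rewrite PKT_determ // mulr_gt0 ?invr_gt0 ?exprn_gt0 ?ltr0n //.
by apply: prodr_gt0 => c _; apply: kt_run_gt0.
Qed.

(* Lengthening the context splits each run, which loses by [kt_run_mul]; the
   occurrence of the length-[k] context at the very start of [s] is the one
   with no predecessor, and it is paid for by the extra factor [1 / #|A|]. *)
Lemma PKT_leS s k : (0 < #|A|)%N -> (k.+1 < size s)%N -> determ s k ->
  PKT R s k.+1 <= PKT R s k.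
Proof.
move=> A0 ks ds; have s0 : (0 < size s)%N by apply: leq_ltn_trans ks.
rewrite !PKT_determ //; last exact: determS.
rewrite (@big_tuple_cons _ _ _ _ k (fun c => kt_run (Ncnt s (size s).-1 c))).
rewrite exchange_big /=.
have Aunit : #|A|%:R != 0 :> R by rewrite pnatr_eq0 -lt0n.
have -> : #|A|%:R ^- k.+1 = #|A|%:R ^- k *
    \prod_(c : k.-tuple A) kt_run (take k s == c).
  rewrite exprS invfM mulrC; congr (_ * _).
  have tk : size (take k s) == k by rewrite size_takel // ltnW // ltnW.
  rewrite (bigD1 (Tuple tk)) //= eqxx big1 ?mulr1.
    by rewrite /kt_run big_nat1 !add0r; field.
  move=> c; rewrite -val_eqE /= eq_sym => /negbTE ->.
  by rewrite /kt_run big_geq.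
rewrite -mulrA ler_wpM2l ?invr_ge0 ?exprn_ge0 // -big_split /=.
apply: ler_prod => c _; apply/andP; split.
  rewrite mulr_ge0 ?(ltW (kt_run_gt0 _ _)) // prodr_ge0 // => b _.
  by rewrite ltW // kt_run_gt0.
rewrite (@Ncnt_cons_sum _ s (size s).-1 c) ?leq_pred ?size_tuple //; last first.
  by rewrite -ltnS prednK // ltnW.
apply: le_trans (kt_run_mul _ _ A0).
by rewrite ler_wpM2l ?(ltW (kt_run_gt0 _ _)) // kt_run_prod_leq.
Qed.

Lemma PKT_leq s k m : (0 < #|A|)%N -> (k <= m < size s)%N -> determ s k ->
  PKT R s m <= PKT R s k.
Proof.
move=> A0 /andP[/subnK <-]; elim: (m - k)%N => // l IHl ls ds.
apply: le_trans (IHl (ltnW ls) ds); apply: PKT_leS => //.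
by apply: determ_leq ds; rewrite leq_addl.
Qed.

Definition information_criterion (IC : seq A -> nat -> R) : Prop :=
  (exists pen : nat -> R, penalty_function pen /\ (forall m, 0 <= pen m)
                          /\ IC = PML_IC pen)
  \/ IC = @NML_IC R A \/ IC = @KT_IC R A.

(** From order [k] on the likelihood is [1]. PML and NML reduce to their penalty terms, which are
    nondecreasing in the order (for PML since [pen] is nonnegative); KT is handled by [PKT_leq]. *)
Lemma khat_determ (IC : seq A -> nat -> R) s k : (0 < #|A|)%N ->
  information_criterion IC ->
  (0 < size s)%N -> determ s k -> (khat IC s <= k)%N.
Proof.
move=> A0 hIC s0 ds; apply: khat_leq => // m /andP[km ms].
have dsm := determ_leq km ds.
case: hIC => [[pen [_ [pen0 ->]]]|[->|->]].
- rewrite /PML_IC !ML_determ // log2_1 oppr0 !add0r ler_wpM2r // ler_nat.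
  by rewrite leq_mul2l leq_pexp2l ?orbT.
- rewrite /NML_IC !ML_determ // log2_1 oppr0 !add0r.
  by have /andP[S0 S1] := NMLsum_leq A0 s0 km; apply: log2_le.
- rewrite /KT_IC lerN2 log2_le ?PKT_gt0 //.
  by apply: PKT_leq; rewrite ?km.
Qed.

End Criteria.

(** * Cylinder sets in path space *)

Section Windows.
Variable A : finType.
Implicit Types (u v : seq A) (x : int -> A) (z : int).

Definition window x z n : seq A := [seq x (z + i%:Z) | i <- iota 0 n].

Definition cyl z u : set (int -> A) := [set x | window x z (size u) = u].

Lemma size_window x z n : size (window x z n) = n.
Proof. by rewrite size_map size_iota. Qed.

Lemma nth_window a x z n i : (i < n)%N -> nth a (window x z n) i = x (z + i%:Z).
Proof. by move=> ilt; rewrite (nth_map 0%N) ?size_iota // nth_iota. Qed.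

Lemma cyl_rcons z u b :
  cyl z (rcons u b) = cyl z u `&` [set x | x (z + (size u)%:Z) = b].
Proof.
apply/seteqP; split=> x; rewrite /cyl /window /= size_rcons -addn1 iotaD map_cat
  /= add0n cats1.
  by move=> /eqP; rewrite eqseq_rcons => /andP[/eqP ? /eqP].
by move=> [-> ->].
Qed.

Lemma preimage_shift_cyl z u : path_shift @^-1` cyl z u = cyl (z + 1) u.
Proof.
apply/seteqP; split=> x; rewrite /cyl /window /path_shift /= => {2}<-;
  by apply: eq_map => i; rewrite addrAC.
Qed.

Lemma past_agreeE u : past_agree (in_tuple u) = cyl (- (size u)%:Z) u.
Proof.
apply/seteqP; split => x; rewrite /cyl /past_agree /=.
  move=> xu; case: (posnP (size u)) => [/size0nil -> //|u0].
  have a : A by case: (u) u0.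
  apply: (@eq_from_nth _ a); rewrite size_window // => i ilt.
  rewrite nth_window // addrC.
  by have := xu (Ordinal ilt); rewrite /= (tnth_nth a).
move=> xu j; pose a := tnth (in_tuple u) j.
by rewrite (tnth_nth a) /= -(congr1 (fun s => nth a s j) xu) nth_window // addrC.
Qed.

Lemma path_measurable_setT : path_measurable [set: int -> A].
Proof.
rewrite -[setT]setD0; apply: sigma_algebraCD; apply: sigma_algebra0.
Qed.

Lemma path_measurable_bigcap (F : (set (int -> A))^nat) :
  (forall n, path_measurable (F n)) -> path_measurable (\bigcap_n F n).
Proof.
move=> mF; rewrite -[X in path_measurable X]setCK setC_bigcap -setTD.
apply: sigma_algebraCD; apply: sigma_algebra_bigcup => n.
by rewrite -setTD; apply: sigma_algebraCD; apply: mF.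
Qed.

Lemma path_measurableI (B C : set (int -> A)) :
  path_measurable B -> path_measurable C -> path_measurable (B `&` C).
Proof.
move=> mB mC; rewrite -bigcap2E; apply: path_measurable_bigcap => -[//|[//|n]].
exact: path_measurable_setT.
Qed.

Lemma path_measurable_cyl z u : path_measurable (cyl z u).
Proof.
elim/last_ind: u => [|u b IHu].
  rewrite (_ : cyl z [::] = setT); last by apply/seteqP; split.
  exact: path_measurable_setT.
rewrite cyl_rcons; apply: path_measurableI => //.
by apply: sub_sigma_algebra; exists (z + (size u)%:Z) => //; exists b.
Qed.

End Windows.

(** * Cylinder probabilities of the process *)

Section Process.
Context (d : measure_display) (T : measurableType d) (R : realType).
Variables (P : probability T R) (A : finType) (X : int -> T -> A).
Implicit Types (u v : seq A) (z : int) (a b : A).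
Hypothesis mX : forall i a, measurable [set w | X i w = a].

Lemma measurable_path B : path_measurable B -> measurable (path_of X @^-1` B).
Proof.
move: B; apply: smallest_sub.
  split=> [|B mB|F mF].
  - by rewrite preimage_set0.
  - by rewrite setTD preimage_setC; apply: measurableC.
  - by rewrite preimage_bigcup; apply: bigcupT_measurable.
by move=> _ [i _ [a _ <-]]; apply: mX.
Qed.

Definition prob (B : set (int -> A)) : R := fine (P (path_of X @^-1` B)).

Lemma probE B : path_measurable B -> P (path_of X @^-1` B) = (prob B)%:E.
Proof. by move=> mB; rewrite fineK // fin_num_measure //; apply: measurable_path. Qed.

Lemma prob_ge0 B : 0 <= prob B.
Proof. exact: fine_ge0. Qed.

Lemma prob_le B C : path_measurable B -> path_measurable C -> B `<=` C ->
  prob B <= prob C.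
Proof.
move=> mB mC BC; rewrite -lee_fin -!probE //; apply: le_measure; rewrite ?inE //;
  by [apply: measurable_path | apply: preimage_subset].
Qed.

Lemma sum_prob_partition (I : finType) (F : I -> set (int -> A)) B :
  (forall i, path_measurable (F i)) -> path_measurable B ->
  (forall i j x, F i x -> F j x -> i = j) -> (forall x, B x <-> exists i, F i x) ->
  \sum_i prob (F i) = prob B.
Proof.
move=> mF mB disj BF; apply: EFin_inj; rewrite -sumEFin -probE //.
under eq_bigr => i _ do rewrite -(probE (mF i)).
have -> : path_of X @^-1` B =
    \bigcup_(i in [set` index_enum I]) (path_of X @^-1` F i).
  apply/seteqP; split=> w /=.
    by move=> /BF[i Fi]; exists i; rewrite //= mem_index_enum.
  by move=> [i _ Fi]; apply/BF; exists i.
rewrite measure_fin_bigcup; last 3 first.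
- exact: finite_seq.
- apply/trivIsetP => i j _ _ /eqP ij; apply/seteqP; split=> w //.
  by move=> [Fi Fj]; apply: ij; apply: disj Fi Fj.
- by move=> i _; apply: measurable_path.
by rewrite fsbig_seq // index_enum_uniq.
Qed.

Lemma sum_prob_rcons z u : \sum_b prob (cyl z (rcons u b)) = prob (cyl z u).
Proof.
apply: sum_prob_partition => [b||b c x|x]; try exact: path_measurable_cyl.
  by rewrite !cyl_rcons => -[_ /= <-] [_ /= <-].
split=> [ux|[b]]; last by rewrite cyl_rcons => -[].
by exists (x (z + (size u)%:Z)); rewrite cyl_rcons.
Qed.

Lemma prob_setT : prob setT = 1.
Proof. by rewrite /prob preimage_setT probability_setT. Qed.

Lemma sum_prob_tuple z n : \sum_(u : n.-tuple A) prob (cyl z u) = 1.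
Proof.
rewrite -prob_setT.
apply: sum_prob_partition => [u||u v x|x].
- exact: path_measurable_cyl.
- exact: path_measurable_setT.
- rewrite /cyl /= !size_tuple => xu xv; apply: val_inj.
  by rewrite /= -xu -xv.
split=> // _; have ss : size (window x z n) == n by rewrite size_window.
by exists (Tuple ss); rewrite /cyl /= size_window.
Qed.

Lemma prob_cyl_rcons_le z u b : prob (cyl z (rcons u b)) <= prob (cyl z u).
Proof.
by apply: prob_le; try exact: path_measurable_cyl; rewrite cyl_rcons => x [].
Qed.

Lemma prob_cyl_cat_le z u v : prob (cyl z (u ++ v)) <= prob (cyl z u).
Proof.
elim/last_ind: v => [|v b IHv]; first by rewrite cats0.
by rewrite -rcons_cat (le_trans (prob_cyl_rcons_le _ _ _)).
Qed.

Lemma prob_nil z : prob (cyl z [::]) = 1.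
Proof. by rewrite -prob_setT; congr prob; apply/seteqP; split. Qed.

Hypothesis stat : forall B, path_measurable B ->
  P (path_of X @^-1` (path_shift @^-1` B)) = P (path_of X @^-1` B).

Lemma prob_cyl_stationary z z' u : prob (cyl z u) = prob (cyl z' u).
Proof.
have step z0 n : prob (cyl (z0 + n%:Z) u) = prob (cyl z0 u).
  elim: n => [|n <-]; first by rewrite addr0.
  rewrite /prob -(stat (path_measurable_cyl (z0 + n%:Z) u)) preimage_shift_cyl.
  by rewrite -addrA [n%:Z + 1]addrC -intS.
case: (leP z z') => [|/ltW] zz'.
  by rewrite -(step z `|z' - z|%N) gez0_abs ?subr_ge0 // subrKC.
by rewrite -(step z' `|z - z'|%N) gez0_abs ?subr_ge0 // subrKC.
Qed.

Variable p : A -> (int -> A) -> R.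
Hypothesis p_ge0 : forall a x, 0 <= p a x.
Hypothesis p_sum : forall x, \sum_a p a x = 1.
Hypothesis mp : forall a (B : set R), measurable B -> path_measurable (p a @^-1` B).
Hypothesis pE : forall a (k : nat) (y : k.-tuple A),
  P [set w | X 0 w = a /\ past_agree y (path_of X w)] =
  (\int[P]_(w in [set w | past_agree y (path_of X w)]) (p a (path_of X w))%:E)%E.

(** A summand of [alpha], for pasts ending in [u]; with [u = [::]] all pasts are allowed. *)
Definition pinf a u : R := inf [set p a x | x in past_agree (in_tuple u)].

Lemma p_has_lbound a B : has_lbound [set p a x | x in B].
Proof. by exists 0 => _ [x _ <-]; apply: p_ge0. Qed.

Lemma p_inf_ge0 a B : 0 <= inf [set p a x | x in B].
Proof.
have [->|/set0P B0] := eqVneq B set0; first by rewrite image_set0 inf0.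
by apply: lb_le_inf => [|_ [x _ <-] //]; apply: image_nonempty.
Qed.

Lemma pinf_ge0 a u : 0 <= pinf a u.
Proof. exact: p_inf_ge0. Qed.

Lemma p_le1 a x : p a x <= 1.
Proof. by rewrite -(p_sum x) (bigD1 a) //= lerDl sumr_ge0. Qed.

Lemma pinf_le a u x : cyl (- (size u)%:Z) u x -> pinf a u <= p a x.
Proof.
by move=> ux; apply: ge_inf; [apply: p_has_lbound | exists x; rewrite ?past_agreeE].
Qed.

Lemma alpha_le u : alpha p (size u) <= \sum_a pinf a u.
Proof.
apply: ge_inf; last by exists (in_tuple u).
by exists 0 => _ [y _ <-]; apply: sumr_ge0 => a _; apply: p_inf_ge0.
Qed.

(** By stationarity the word [u ++ v] may end at time [-1]. Then [pE] writes the right side as the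
    integral of [p a] over its cylinder, where [p a] is at least [pinf a v] because every such past
    ends in [v]. *)
Lemma prob_rcons_ge z u v a :
  pinf a v * prob (cyl z (u ++ v)) <= prob (cyl z (rcons (u ++ v) a)).
Proof.
set y := u ++ v; pose k : int := - (size y)%:Z.
rewrite !(prob_cyl_stationary z k) -lee_fin EFinM -!probE;
  [|exact: path_measurable_cyl..].
have mD : measurable (path_of X @^-1` cyl k y).
  by apply: measurable_path; apply: path_measurable_cyl.
have -> : path_of X @^-1` cyl k (rcons y a) =
    [set w | X 0 w = a /\ past_agree (in_tuple y) (path_of X w)].
  by rewrite past_agreeE cyl_rcons /k addNr; apply/seteqP; split => w [].
rewrite pE (_ : [set w | _] = path_of X @^-1` cyl k y); last first.
  by rewrite past_agreeE.
rewrite -integral_cst //; apply: ge0_le_integral => //.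
- by move=> w _; rewrite lee_fin pinf_ge0.
- apply/measurable_realfun.measurable_EFinP => _ B mB.
  by apply: measurableI => //; apply: (measurable_path (mp a mB)).
move=> w yw; rewrite lee_fin; apply: pinf_le.
move: yw; rewrite /cyl /k /y /=; rewrite size_cat /window iotaD map_cat => /eqP.
rewrite eqseq_cat ?size_map ?size_iota // => /andP[_ /eqP vE].
rewrite -[RHS]vE add0n -[in RHS](addn0 (size u)) iotaDl -map_comp; apply: eq_map => i /=.
by congr (path_of X w _); lia.
Qed.

(** * Geometric decay of word probabilities *)

Section Decay.
Variable a : A.

(** After [nseq i a] the letters other than [a] take at least the share
    [alpha p i - pinf a (nseq i a)] of the mass. *)
Lemma prob_nseq_rcons_le z u i :
  prob (cyl z (rcons (u ++ nseq i a) a)) <=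
  (1 - (alpha p i - pinf a (nseq i a))) * prob (cyl z (u ++ nseq i a)).
Proof.
set v := nseq i a; set m := prob (cyl z (u ++ v)).
have sum_ge : prob (cyl z (rcons (u ++ v) a)) + \sum_(b | b != a) pinf b v * m <= m.
  rewrite /m -[leRHS]sum_prob_rcons [leRHS](bigD1 a) //= lerD2l.
  by apply: ler_sum => b _; apply: prob_rcons_ge.
have := alpha_le v; rewrite size_nseq (bigD1 a) //= => al.
rewrite mulrBl mul1r lerBrDr; apply: le_trans sum_ge; rewrite lerD2l -mulr_suml.
by rewrite ler_wpM2r ?prob_ge0 // lerBlDl.
Qed.

Lemma prob_rcons_neq_le z u b : b != a ->
  prob (cyl z (rcons u b)) <= (1 - pinf a [::]) * prob (cyl z u).
Proof.
move=> ba; have := prob_rcons_ge z u [::] a; rewrite cats0 => age.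
rewrite mulrBl mul1r lerBrDr.
apply: (@le_trans _ _ (prob (cyl z (rcons u b)) + prob (cyl z (rcons u a)))).
  by rewrite lerD2l.
rewrite -[leRHS]sum_prob_rcons (bigD1 b) //= (bigD1 a) 1?eq_sym //= lerD2l lerDl.
by apply: sumr_ge0 => c _; apply: prob_ge0.
Qed.

Variables (i0 : nat) (rho : R).
Hypotheses (rho_alpha : 1 - (alpha p i0 - pinf a (nseq i0 a)) <= rho)
  (rho_pinf : 1 - pinf a [::] <= rho) (rho_ge0 : 0 <= rho).

(** If the block is all [a], its last letter follows [i0] copies of [a] and costs a factor [rho];
    otherwise a letter other than [a] costs that factor. The remaining letters cannot raise the
    probability. *)
Lemma prob_block_le z u v : size v = i0.+1 ->
  prob (cyl z (u ++ v)) <= rho * prob (cyl z u).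
Proof.
move=> sv; have [va|/allPn[b /splitPr[v1 v2] /= ba]] := boolP (all (pred1 a) v).
  move/all_pred1P: va; rewrite sv -addn1 nseqD => ->; rewrite catA cats1.
  apply: le_trans (prob_nseq_rcons_le _ _ _) _.
  apply: le_trans (_ : _ <= rho * prob (cyl z (u ++ nseq i0 a))) _.
    by rewrite ler_wpM2r ?prob_ge0.
  by rewrite ler_wpM2l // prob_cyl_cat_le.
rewrite -cat_rcons catA; apply: le_trans (prob_cyl_cat_le _ _ _) _.
rewrite -rcons_cat; apply: le_trans (prob_rcons_neq_le _ _ ba) _.
apply: le_trans (_ : _ <= rho * prob (cyl z (u ++ v1))) _.
  by rewrite ler_wpM2r ?prob_ge0.
by rewrite ler_wpM2l // prob_cyl_cat_le.
Qed.

Lemma prob_blocks_le z u v :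
  prob (cyl z (u ++ v)) <= rho ^+ (size v %/ i0.+1) * prob (cyl z u).
Proof.
(* The quotient is generalized to any [q] such that [q] blocks of length [i0.+1] fit in [v]. *)
move: (size v %/ i0.+1)%N (leq_trunc_div (size v) i0.+1) => q.
elim: q u v => [|q IHq] u v qv.
  by rewrite expr0 mul1r prob_cyl_cat_le.
rewrite -(cat_take_drop i0.+1 v) catA; apply: le_trans (IHq _ _ _) _.
  by rewrite size_drop leq_subRL -?mulSn // (leq_trans _ qv) // mulSn leq_addr.
rewrite exprSr -mulrA ler_wpM2l ?exprn_ge0 // prob_block_le // size_takel //.
by rewrite (leq_trans _ qv) // mulSn leq_addr.
Qed.

(** * Repeated words in the sample and the union bound *)

Lemma sampleE n w : sample X n w = window (path_of X w) 1 n.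
Proof. by apply: eq_map => i; rewrite intS. Qed.

Lemma size_sample n w : size (sample X n w) = n.
Proof. by rewrite sampleE size_window. Qed.

Lemma measurable_sample n (Q : seq A -> Prop) :
  measurable [set w | Q (sample X n w)].
Proof.
rewrite (_ : [set w | _] = \bigcup_(t in [set t : n.-tuple A | Q t])
    (path_of X @^-1` cyl 1 t)).
  apply: fin_bigcup_measurable => [|t _]; first exact: finite_finset.
  by apply: measurable_path; apply: path_measurable_cyl.
apply/seteqP; split=> w /=; rewrite sampleE.
  move=> Qw; have ss : size (window (path_of X w) 1 n) == n by rewrite size_window.
  by exists (Tuple ss) => //=; rewrite /cyl /= size_window.
by move=> [t Qt]; rewrite /cyl /= size_tuple => ->.
Qed.

Lemma measure_big_le (I : Type) (r : seq I) (F : I -> set T) :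
  (forall i, measurable (F i)) ->
  (P (\big[setU/set0]_(i <- r) F i) <= \sum_(i <- r) P (F i))%E.
Proof.
move=> mF; elim: r => [|i r IHr]; first by rewrite !big_nil measure0.
rewrite !big_cons; apply: le_trans (measureU2 _ _ _) _ => //.
  exact: bigsetU_measurable.
by rewrite leeD2l.
Qed.

(* [iter k (copy_back l) u] is the only word of length [size u + k] that extends
   [u] and in which every new letter repeats the one [l] places before. *)
Definition copy_back l u := rcons u (nth a u (size u - l)).

Lemma iter_copy_back l k u :
  exists2 v, iter k (copy_back l) u = u ++ v & size v = k.
Proof.
elim: k => [|k [v e sv]]; first by exists [::]; rewrite ?cats0.
exists (rcons v (nth a (u ++ v) (size (u ++ v) - l))); last by rewrite size_rcons sv.
by rewrite iterS e -rcons_cat.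
Qed.

(** The two occurrences may overlap: if [i + t >= j], the letter being copied was itself produced by
    an earlier copy. *)
Lemma window_copy_back x i j k : (i < j)%N ->
  (forall t, (t < k)%N -> x (1 + (i + t)%:Z) = x (1 + (j + t)%:Z)) ->
  window x 1 (j + k) = iter k (copy_back (j - i)) (window x 1 j).
Proof.
move=> ij; elim: k => [|k IHk] xk; first by rewrite addn0.
rewrite iterS -IHk => [|t tk]; last by apply: xk; rewrite ltnW.
rewrite /copy_back size_window nth_window; last by lia.
rewrite (_ : (j + k - (j - i))%N = (i + k)%N); last by lia.
by rewrite xk // /window addnS -addn1 iotaD map_cat cats1 add0n.
Qed.

(** Each prefix [u] of length [j] leaves one continuation of length [k], which costs the power of
    [rho] from [prob_blocks_le]; the prefix probabilities sum to [1]. *)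
Lemma prob_repeat_le i j k n : (i < j)%N -> (j + k <= n)%N ->
  (P [set w | take k (drop i (sample X n w)) = take k (drop j (sample X n w))]
    <= (rho ^+ (k %/ i0.+1))%:E)%E.
Proof.
move=> ij jkn.
pose F (u : j.-tuple A) := path_of X @^-1` cyl 1 (iter k (copy_back (j - i)) u).
have mF t : measurable (F t).
  by apply: measurable_path; apply: path_measurable_cyl.
apply: (@le_trans _ _ (P (\big[setU/set0]_t F t))).
  apply: le_measure; rewrite ?inE.
  - exact: (@measurable_sample n (fun s => take k (drop i s) = take k (drop j s))).
  - exact: bigsetU_measurable.
  move=> w /= weq; rewrite -bigcup_seq.
  have ss : size (window (path_of X w) 1 j) == j by rewrite size_window.
  exists (Tuple ss); first by rewrite /= mem_index_enum.
  rewrite /F /= -window_copy_back //; first by rewrite /cyl /= size_window.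
  move=> t tk; have := congr1 (fun s => nth a s t) weq.
  by rewrite /= !nth_take // !nth_drop !sampleE !nth_window //; lia.
apply: le_trans (measure_big_le _ mF) _.
under eq_bigr => t _ do rewrite /F (probE (path_measurable_cyl _ _)).
rewrite sumEFin lee_fin.
apply: (@le_trans _ _ (\sum_(u : j.-tuple A) rho ^+ (k %/ i0.+1) * prob (cyl 1 u))).
  apply: ler_sum => u _; have [v -> <-] := iter_copy_back (j - i) k u.
  exact: prob_blocks_le.
rewrite -mulr_sumr -[leRHS]mulr1 ler_wpM2l ?exprn_ge0 //.
by rewrite sum_prob_tuple.
Qed.


Lemma prob_khat_le (IC : seq A -> nat -> R) k n : (0 < #|A|)%N ->
  information_criterion IC -> (0 < n)%N ->
  (P [set w | (k < khat IC (sample X n w))%N] <=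
    (n%:R ^+ 2 * rho ^+ (k %/ i0.+1))%:E)%E.
Proof.
move=> A0 hIC n0.
pose rep i j := [set w | take k (drop i (sample X n w)) =
                         take k (drop j (sample X n w))].
(* Pairs out of range get the empty set, so that the union bound sums one constant over all [n ^ 2]
   pairs. *)
pose F (ij : 'I_n * 'I_n) : set T :=
  if (ij.1 < ij.2)%N && (ij.2 + k <= n)%N then rep ij.1 ij.2 else set0.
have mF ij : measurable (F ij).
  rewrite /F; case: ifP => // _.
  exact: (@measurable_sample n (fun s => take k (drop ij.1 s) = take k (drop ij.2 s))).
apply: (@le_trans _ _ (P (\big[setU/set0]_ij F ij))).
  apply: le_measure; rewrite ?inE.
  - exact: (@measurable_sample n (fun s => (k < khat IC s)%N)).
  - exact: bigsetU_measurable.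
  move=> w /= kw; rewrite -bigcup_seq; apply: contrapT => nF.
  (* Without a repetition no two distinct windows agree, so the sample is determined at order [k],
     and [khat_determ] contradicts [kw]. *)
  suff ds : determ (sample X n w) k.
    by move: kw; rewrite ltnNge (khat_determ A0 hIC) // size_sample.
  have norep i j : (i < j)%N -> (j + k < n)%N ->
      take k (drop i (sample X n w)) <> take k (drop j (sample X n w)).
    move=> ij jk e; apply: nF.
    have jn : (j < n)%N by rewrite (leq_ltn_trans _ jk) ?leq_addr.
    exists (Ordinal (ltn_trans ij jn), Ordinal jn); first by rewrite /= mem_index_enum.
    by rewrite /F /= ij ltnW.
  move=> i j; rewrite size_sample => ik jk e.
  by case: (ltngtP i j) => [ij|ji|-> //];
    [case: (norep _ _ ij jk) | case: (norep _ _ ji ik)].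
apply: le_trans (measure_big_le _ mF) _.
apply: (@le_trans _ _ (\sum_(ij : 'I_n * 'I_n) (rho ^+ (k %/ i0.+1))%:E)%E).
  apply: lee_sum => ij _; rewrite /F; case: ifP => [/andP[]|_].
    exact: prob_repeat_le.
  by rewrite measure0 lee_fin exprn_ge0.
rewrite sumEFin lee_fin sumr_const card_prod card_ord.
by rewrite -[leLHS]mulr_natl natrM -expr2.
Qed.

End Decay.

(** * The case of a constant process *)

Lemma cyl_nseq z a n x :
  cyl z (nseq n a) x <-> forall i, (i < n)%N -> x (z + i%:Z) = a.
Proof.
rewrite /cyl /= size_nseq; split=> [xa i ilt|xa].
  by rewrite -(nth_window a x z ilt) xa nth_nseq ilt.
apply: (@eq_from_nth _ a); rewrite size_window ?size_nseq // => i ilt.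
by rewrite nth_window // xa // nth_nseq ilt.
Qed.

Lemma pinf_nseq_ge a n : pinf a [::] <= pinf a (nseq n a).
Proof.
apply: lb_le_inf.
  (* The constant path shows that the infimum is not over the empty set, where it would be [0]. *)
  apply: image_nonempty; exists (fun=> a); rewrite past_agreeE.
  by rewrite size_nseq; apply/cyl_nseq.
by move=> _ [x _ <-]; apply: pinf_le; rewrite /cyl.
Qed.

Lemma pinf_nseq_le1 a n : pinf a (nseq n a) <= 1.
Proof.
apply: le_trans (p_le1 a (fun=> a)); apply: pinf_le.
by rewrite size_nseq; apply/cyl_nseq.
Qed.

Lemma prob_nseq_ge z a n :
  \prod_(0 <= i < n) pinf a (nseq i a) <= prob (cyl z (nseq n a)).
Proof.
elim: n => [|n IHn].
  by rewrite big_geq // prob_nil.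
have -> : nseq n.+1 a = rcons (nseq n a) a by rewrite -addn1 nseqD cats1.
rewrite big_nat_recr //= mulrC; apply: le_trans (prob_rcons_ge z [::] (nseq n a) a).
by rewrite ler_wpM2l ?pinf_ge0.
Qed.

(** Turns a bound on a sum of defects [1 - y] into a lower bound on the product of the [y]. *)
Lemma expR_le_self (y c : R) : 0 < c -> c <= y -> y <= 1 ->
  expR (- ((1 - y) / c)) <= y.
Proof.
move=> c0 cy y1; have y0 : 0 < y by apply: lt_le_trans cy.
rewrite expRN -[leRHS]invrK lef_pV2 ?posrE ?invr_gt0 ?expR_gt0 //.
(* [1 / y <= expR (1 / y - 1)] *)
apply: (@le_trans _ _ (expR ((1 - y) / y))).
  apply: le_trans (expR_ge1Dx _).
  by rewrite mulrBl divff ?gt_eqF // mul1r addrC subrK.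
by rewrite ler_expR ler_wpM2l ?subr_ge0 // lef_pV2 ?posrE.
Qed.

Hypothesis erg : forall B, path_measurable B -> path_shift @^-1` B = B ->
  P (path_of X @^-1` B) = 0%E \/ P (path_of X @^-1` B) = 1%E.

Lemma constant_process a :
  0 < pinf a [::] -> (forall i, alpha p i <= pinf a (nseq i a)) ->
  cvg (series ((fun k => 1 - alpha p k) : R^nat) @ \oo) ->
  P [set w | forall i, X i w = a] = 1%E.
Proof.
set c := pinf a [::] => c0 al cv.
have [S seriesS] : exists S : R,
    forall n, series ((fun k => 1 - alpha p k) : R^nat) n <= S.
  have [M [_ MS]] := cvg_seq_bounded cv.
  (* Boundedness is available only for numbers strictly above [M], hence [M + 1]. *)
  exists (M + 1) => n; apply: le_trans (ler_norm _) _.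
  by apply: MS => //; rewrite ltrDl.
(* The bound is uniform in [n]: the factors lie in [[c, 1]] and their defects, at most
   [1 - alpha p i], sum to at most [S]. *)
have nseq_ge z n : expR (- (S / c)) <= prob (cyl z (nseq n a)).
  apply: le_trans (prob_nseq_ge _ _ _).
  apply: (@le_trans _ _ (\prod_(0 <= i < n) expR (- ((1 - alpha p i) / c)))).
    rewrite -expR_sum ler_expR sumrN -mulr_suml lerN2.
    by rewrite ler_wpM2r ?invr_ge0 ?(ltW c0) //; apply: seriesS.
  rewrite !big_mkord; apply: ler_prod => i _; rewrite expR_ge0 /=.
  apply: le_trans (expR_le_self c0 (pinf_nseq_ge _ _) (pinf_nseq_le1 _ _)).
  by rewrite ler_expR lerN2 ler_wpM2r ?invr_ge0 ?(ltW c0) // lerD2l lerN2.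
(* Windows [[-n, n]], decreasing to the invariant event that every coordinate is [a]. *)
pose F n := cyl (- n%:Z) (nseq n.*2.+1 a).
have mF n : path_measurable (F n) by apply: path_measurable_cyl.
have FE : \bigcap_n F n = [set x | forall i, x i = a].
  apply/seteqP; split=> x /= xa i; last by move=> _; apply/cyl_nseq => j _.
  have /cyl_nseq/(_ (absz (i + (absz i)%:Z))) := xa `|i|%N I.
  rewrite (_ : - _ + _ = i); last by lia.
  by apply; lia.
have mB : path_measurable [set x : int -> A | forall i, x i = a].
  by rewrite -FE; apply: path_measurable_bigcap.
have shiftB : path_shift @^-1` [set x | forall i, x i = a] = [set x | forall i, x i = a].
  apply/seteqP; split=> x /= xa i; last exact: xa.
  by rewrite -(subrK 1 i); apply: xa.
(* Probability [0] is excluded: by continuity from above the limit event inherits the uniform lower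
   bound. *)
case: (erg mB shiftB) => // B0; exfalso.
have : ((expR (- (S / c)))%:E <= P (path_of X @^-1` [set x | forall i, x i = a]))%E.
  rewrite -FE preimage_bigcap.
  have cvP : (P \o (fun n => path_of X @^-1` F n)) n @[n --> \oo] -->
      P (\bigcap_n (path_of X @^-1` F n)).
    apply: nonincreasing_cvg_mu.
    - by rewrite (le_lt_trans (probability_le1 _ _)) ?ltry //; apply: measurable_path.
    - by move=> n; apply: measurable_path.
    - by apply: bigcapT_measurable => n; apply: measurable_path.
    move=> m n mn; rewrite subsetEset; apply: preimage_subset => x.
    move=> /cyl_nseq xa; apply/cyl_nseq => i im.
    by rewrite -(xa (i + (n - m))%N); [congr (x _); lia | lia].
  rewrite -(cvg_lim _ cvP) //; apply: lime_ge; first by apply/cvg_ex; eexists; exact: cvP.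
  by apply: nearW => n /=; rewrite probE // lee_fin; apply: nseq_ge.
by rewrite B0 lee_fin leNgt expR_gt0.
Qed.

Lemma prob_khat_constant a (IC : seq A -> nat -> R) k n :
  P [set w | forall i, X i w = a] = 1%E -> (0 < #|A|)%N ->
  information_criterion IC -> (0 < n)%N ->
  P [set w | (k < khat IC (sample X n w))%N] = 0%E.
Proof.
set C := [set w | _]; move=> C1 A0 hIC n0.
have mC : measurable C.
  (* Times [m] and [- m] are paired to make the intersection over integers one over naturals. *)
  rewrite (_ : C = \bigcap_m ([set w | X m%:Z w = a] `&` [set w | X (- m%:Z) w = a])).
    by apply: bigcapT_measurable => m; apply: measurableI.
  apply/seteqP; split=> w /= Xw m; first by move=> _; split; apply: Xw.
  have [Xm XNm] := Xw `|m|%N I.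
  by case: (leP 0 m) => [m0|/ltW m0]; [rewrite -Xm | rewrite -XNm]; congr (X _ w); lia.
have mE := @measurable_sample n (fun s => (k < khat IC s)%N).
apply/eqP; rewrite -measure_le0 (_ : 0%E = P (~` C)).
  apply: le_measure; rewrite ?inE //; first exact: measurableC.
  move=> w /= kw Cw; move: kw; rewrite ltnNge (khat_determ A0 hIC) //.
    by rewrite size_sample.
  apply: (@determ_leq _ _ 0) => //; apply: (@determ_const _ _ a) => i.
  by rewrite size_sample sampleE => ilt; rewrite nth_window //; apply: Cw.
by rewrite probability_setC // C1 subee.
Qed.

End Process.

(** * Explicit constants and conclusion *)

Lemma geometric_powR (R : realType) (rho : R) (n m k : nat) :
  0 < rho -> rho < 1 -> (0 < n)%N ->
  n%:R ^+ 2 * rho ^+ (k %/ m.+1) <=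
  2 `^ (log2 rho^-1 + 2 * log2 n%:R - log2 rho^-1 / m.+1%:R * k%:R).
Proof.
move=> rho0 rho1 n0.
have ln2 : 0 < ln 2 :> R by rewrite ln_gt0 ?ltr1n.
have n0R : 0 < n%:R :> R by rewrite ltr0n.
have L0 : 0 < ln rho^-1 by rewrite ln_gt0 // invf_gt1.
rewrite /powR pnatr_eq0 /= /log2.
set L := ln rho^-1 in L0 *.
rewrite (_ : _ * ln 2 = ln n%:R * 2%:R + (L - L * (k%:R / m.+1%:R))); last first.
  have m0 : m.+1%:R != 0 :> R by rewrite pnatr_eq0.
  by move: (m.+1%:R : R) m0 => M m0; field; rewrite m0 gt_eqF.
rewrite expRD expRM_natr lnK ?posrE // ler_wpM2l ?exprn_ge0 ?ler0n //.
have -> : rho ^+ (k %/ m.+1) = expR (- L * (k %/ m.+1)%:R).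
  by rewrite expRM_natr /L lnV ?posrE // opprK lnK.
(* The floor loses less than one unit of the exponent, since [k < (k %/ m.+1).+1 * m.+1]; the
   summand [log2 rho^-1] pays for it. *)
rewrite ler_expR mulNr lerNl opprB lerBlDr -[X in _ + X]mulr1 -mulrDr.
rewrite ler_wpM2l ?(ltW L0) //.
rewrite natr1 ler_pdivrMr ?ltr0n // -natrM ler_nat ltnW // ltn_ceil //.
Qed.

Theorem theorem4p5
  (d : measure_display) (T : measurableType d) (R : realType)
  (P : probability T R) (A : finType) (X : int -> T -> A)
  (p : A -> (int -> A) -> R) :
  (1 < #|A|)%N ->
  (* X is a process: each X_i is a measurable A-valued random variable *)
  (forall (i : int) (a : A), measurable [set w | X i w = a]) ->
  (* stationarity *)
  (forall B, path_measurable B ->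
     P (path_of X @^-1` (path_shift @^-1` B)) = P (path_of X @^-1` B)) ->
  (* ergodicity *)
  (forall B, path_measurable B -> path_shift @^-1` B = B ->
     P (path_of X @^-1` B) = 0%E \/ P (path_of X @^-1` B) = 1%E) ->
  (* p a x is (a regular version of) P(X_0 = a | X_{-oo}^{-1} = x_{-oo}^{-1}) *)
  (forall a x, 0 <= p a x) ->
  (forall x, \sum_(a : A) p a x = 1) ->
  (forall a x x', (forall i : int, i < 0 -> x i = x' i) -> p a x = p a x') ->
  (forall a (B : set R), measurable B -> path_measurable (p a @^-1` B)) ->
  (forall (a : A) (k : nat) (y : k.-tuple A),
     P [set w | X 0 w = a /\ past_agree y (path_of X w)] =
     (\int[P]_(w in [set w | past_agree y (path_of X w)]) (p a (path_of X w))%:E)%E) ->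
  (* weakly non-null *)
  0 < alpha p 0 ->
  (* alpha-summable *)
  cvg (series ((fun k => 1 - alpha p k) : R^nat) @ \oo) ->
  exists lambda1 lambda2 : R, 0 < lambda1 /\ 0 < lambda2 /\
    forall IC : seq A -> nat -> R,
      ((exists pen : nat -> R, penalty_function pen /\ (forall m, 0 <= pen m)
                               /\ IC = PML_IC pen)
       \/ IC = @NML_IC R A \/ IC = @KT_IC R A) ->
      forall (kn : nat -> nat) (n : nat), (1 <= n)%N ->
        (P [set w | (kn n < khat IC (sample X n w))%N] <=
          ((2 : R) `^ (lambda1 + 2 * log2 n%:R - lambda2 * (kn n)%:R))%:E)%E.
Proof.
move=> A1 mX stat erg p0 psum _ mp pE alpha0 cv.
have A0 : (0 < #|A|)%N by apply: ltnW.
(* [alpha p 0] is at most the sum of the [pinf p a [::]], so one of these is positive. *)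
have [a pa0] : exists a, 0 < pinf p a [::].
  apply: contrapT => npa; move: alpha0; apply/negP; rewrite -leNgt.
  apply: le_trans (alpha_le p0 [::]) _; apply: sumr_le0 => a _.
  by rewrite leNgt; apply/negP => pa; apply: npa; exists a.
have [al|/existsNP[i0 /negP]] := pselect (forall i, alpha p i <= pinf p a (nseq i a)).
  (* The event is null in this case, so any positive constants do. *)
  exists 1, 1; do 2 split => //; move=> IC hIC kn n n0.
  have Xa := constant_process mX stat p0 psum mp pE erg pa0 al cv.
  by rewrite (prob_khat_constant mX _ Xa A0 hIC) // lee_fin powR_ge0.
rewrite -ltNge => al.
(* The entry [2^-1] keeps [rho] positive; the other two are below [1] by the choice of [a] and
   [i0]. *)
pose rho : R := Num.max 2^-1 (Num.max (1 - pinf p a [::])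
  (1 - (alpha p i0 - pinf p a (nseq i0 a)))).
have rho0 : 0 < rho by rewrite lt_max invr_gt0 ltr0n.
have rho1 : rho < 1.
  by rewrite !gt_max invf_lt1 ?ltr1n //= !gtrDl !oppr_lt0 pa0 subr_gt0.
have rho_pinf : 1 - pinf p a [::] <= rho by rewrite /rho !le_max lexx orbT.
have rho_alpha : 1 - (alpha p i0 - pinf p a (nseq i0 a)) <= rho.
  by rewrite /rho !le_max lexx !orbT.
exists (log2 rho^-1), (log2 rho^-1 / i0.+1%:R).
have L0 : 0 < log2 rho^-1.
  by rewrite /log2 divr_gt0 ?ln_gt0 ?invf_gt1 ?ltr1n.
split=> //; split; first by rewrite divr_gt0.
move=> IC hIC kn n n0.
apply: le_trans (prob_khat_le mX stat p0 mp pE rho_alpha rho_pinf (ltW rho0)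
  (kn n) A0 hIC n0) _.
by rewrite lee_fin geometric_powR.
Qed.
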